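(* Let $(\mathcal T_i)_{i\in\mathbb N_0}$ be a generalised preferential attachment tree with deterministic attachment function $f:\mathbb N_0\to(0,\infty)$, and assume that for some $\kappa>0$ and all $n\in\mathbb N_0$, \[\max_{i\le n}\frac{f(i)}{i+1}\le\kappa\frac{f(n)}{n+1}.\] Then almost surely $(\mathcal T_i)_{i\in\mathbb N_0}$ contains a unique persistent hub.
   Context: Generalised preferential attachment tree with deterministic $f:\mathbb N_0\to(0,\infty)$: $\mathcal T_0$ is a single node labelled $0$; given $\mathcal T_k$ (nodes $0,\dots,k$), choose a node $j$ with probability $f(\deg^+(j,\mathcal T_k))/\mathcal Z_k$, where $\mathcal Z_k=\sum_{j=0}^kf(\deg^+(j,\mathcal T_k))$, and add node $k+1$ with an edge directed from $j$ to $k+1$. $\deg^+(u,T)$ is the out-degree of $u$ in the directed tree $T$ ($-\infty$ if $u\notin T$). For a sequence of directed trees $(\mathcal T_n)$, $u$ is a persistent hub if $\deg^+(u,\mathcal T_n)=\max_{v\in\mathcal T_n}\deg^+(v,\mathcal T_n)$ for all but finitely many $n$; it is a unique persistent hub if moreover every persistent hub equals $u$. *)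

(* Defs.v *)
From HB Require Import structures.
From mathcomp Require Import all_boot all_order all_algebra.
From mathcomp Require Import all_classical all_reals all_analysis.
Set Implicit Arguments. Unset Strict Implicit. Unset Printing Implicit Defensive.
Import Order.TTheory GRing.Theory Num.Theory.
Local Open Scope classical_set_scope.
Local Open Scope ring_scope.

(* A growing tree is encoded by its parent sequence s : nat -> nat:
   T_n has nodes 0..n, and node k+1 is attached (edge s k -> k+1) to s k. *)

(* out-degree of u in T_n (meaningful for u <= n) *)
Definition outdeg (s : nat -> nat) (n u : nat) : nat :=
  count (fun k => s k == u) (iota 0 n).

Definition maxdeg (s : nat -> nat) (n : nat) : nat :=
  \max_(v < n.+1) outdeg s n v.

(* u is a persistent hub of (T_n): for all but finitely many n, u is in T_n
   and deg^+(u,T_n) is maximal (if u is not in T_n its degree is -oo,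
   so it cannot be maximal). *)
Definition persistent_hub (s : nat -> nat) (u : nat) : Prop :=
  exists N, forall n, (N <= n)%N -> (u <= n)%N /\ outdeg s n u = maxdeg s n.

Definition unique_persistent_hub (s : nat -> nat) (u : nat) : Prop :=
  persistent_hub s u /\ forall v, persistent_hub s v -> v = u.

Definition Zpa {R : realType} (f : nat -> R) (s : nat -> nat) (k : nat) : R :=
  \sum_(j < k.+1) f (outdeg s k j).

Definition pa_step {R : realType} (f : nat -> R) (s : nat -> nat) (k : nat) : R :=
  if (s k <= k)%N then f (outdeg s k (s k)) / Zpa f s k else 0.

(* J : nat -> T -> nat is (a version of) the generalised preferential
   attachment tree with attachment function f: the parent sequence has the
   prescribed finite-dimensional distributions. *)
Definition is_GPA_tree {d : measure_display} {T : measurableType d}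
  {R : realType} (P : probability T R) (f : nat -> R) (J : nat -> T -> nat) : Prop :=
  (forall k j, measurable [set w | J k w = j]) /\
  (forall (n : nat) (s : nat -> nat),
     P [set w | forall k, (k < n)%N -> J k w = s k] =
       (\prod_(k < n) pa_step f s k)%:E).

(* Main.v *)
Require Import Defs.
From HB Require Import structures.
From mathcomp Require Import all_boot all_order all_algebra.
From mathcomp Require Import all_classical all_reals all_analysis.
From mathcomp Require Import ring lra.
Set Implicit Arguments. Unset Strict Implicit. Unset Printing Implicit Defensive.
Import Order.TTheory GRing.Theory Num.Theory.
Local Open Scope ring_scope.

(** For two nodes [u], [v] with degrees [a], [b] and any real [lambda],
    [prod_(i < a) (1 - lambda / f i) * prod_(i < b) (1 + lambda / f i)]
    is a martingale: in one step the two factors change at the opposite rates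
    [-lambda / Z] and [lambda / Z].  Three almost sure facts are deduced.

    - When the maximal degree at time [n] is [m], the hypothesis gives
      [Z <= 2 kappa (n + 1) f m / (m + 1)], so the maximum grows with probability
      at least [(m + 1) / (2 kappa (n + 1))].  Hence the maximal degree tends to
      infinity, and its large negative moments are summable in [n].
    - A new node reaches the degree of the current leader, of degree [m], with
      probability at most [2 / prod_(i < m) (1 + p / (i + 1))], by the martingale
      with [lambda = kappa p f m / (m + 1)].  Choosing [p] large, Borel-Cantelli
      shows that only finitely many nodes ever become maximal after their birth.
    - Starting from a tie of two nodes at degree [k], the martingales with
      parameters [lambda] and [2 lambda], where [lambda ^ -2] is of the order of
      [sum_(i >= k) (f i) ^ -2], show that ties at arbitrarily large degrees have
      conditional probability at most some [rho < 1] independent of [k].  The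
      probability of infinitely many such ties is then at most [rho] times
      itself.

    Hence, from some time on, the node of maximal degree is unique among finitely
    many candidates; as degrees grow by unit steps, it can no longer change. *)

(** * Elementary estimates *)

Section ProductBounds.
Variable R : realType.
Implicit Types (y : nat -> R) (m l : nat).

Lemma sum_inv_sqr_le m l : (0 < m)%N ->
  \sum_(m <= i < l) (i.+1%:R ^+ 2)^-1 <= m%:R^-1 :> R.
Proof.
move=> m0; have [ml|lm] := leqP m l; last first.
  by rewrite big_geq ?invr_ge0// ltnW.
suff : \sum_(m <= i < l) (i.+1%:R ^+ 2)^-1 <= m%:R^-1 - l%:R^-1 :> R.
  by move=> /le_trans; apply; rewrite gerBl invr_ge0.
elim: l ml => [|l IH]; first by rewrite leqn0 => /eqP ->; rewrite big_geq// subrr.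
rewrite leq_eqVlt => /orP[/eqP ->|]; first by rewrite big_geq// subrr.
rewrite ltnS => ml; rewrite big_nat_recr//=.
apply: (le_trans (lerD (IH ml) (lexx _))).
have l0 : 0 < l%:R :> R by rewrite ltr0n (leq_trans m0).
rewrite -addrA lerD2l -natr1 -subr_ge0.
rewrite (_ : _ - _ = (l%:R * (l%:R + 1) ^+ 2)^-1); last first.
  by field; rewrite !lt0r_neq0// addr_gt0.
by rewrite invr_ge0 mulr_ge0 ?exprn_ge0 ?addr_ge0// ltW.
Qed.

Lemma prod_one_sub_ge y m l : (forall i, (m <= i)%N -> 0 <= y i <= 1) ->
  1 - \sum_(m <= i < l) y i <= \prod_(m <= i < l) (1 - y i).
Proof.
move=> y01; suff H : 0 <= \prod_(m <= i < l) (1 - y i) <= 1 /\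
    1 - \sum_(m <= i < l) y i <= \prod_(m <= i < l) (1 - y i) by case: H.
have [ml|lm] := leqP m l; last first.
  by rewrite !big_geq ?(ltnW lm)// subr0 ler01 lexx.
elim: l ml => [|l IH]; first by rewrite leqn0 => /eqP ->; rewrite !big_geq// subr0 ler01 lexx.
rewrite leq_eqVlt => /orP[/eqP ->|]; first by rewrite !big_geq// subr0 ler01 lexx.
rewrite ltnS => ml; rewrite !big_nat_recr//=.
have [/andP[P0 P1] le] := IH ml; have /andP[yl0 yl1] := y01 _ ml.
by split; [apply/andP; split|]; nra.
Qed.

Lemma prod_one_sub_le y m l : (forall i, (m <= i)%N -> 0 <= y i <= 1) ->
  \prod_(m <= i < l) (1 - y i) * (1 + \sum_(m <= i < l) y i) <= 1.
Proof.
move=> y01; have [ml|lm] := leqP m l; last first.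
  by rewrite !big_geq ?(ltnW lm)// addr0 mulr1.
suff [] : [/\ 0 <= \prod_(m <= i < l) (1 - y i), 0 <= \sum_(m <= i < l) y i &
  \prod_(m <= i < l) (1 - y i) * (1 + \sum_(m <= i < l) y i) <= 1] by [].
elim: l ml => [|l IH].
  by rewrite leqn0 => /eqP ->; rewrite !big_geq// addr0 mulr1.
rewrite leq_eqVlt => /orP[/eqP ->|]; first by rewrite !big_geq// addr0 mulr1.
rewrite ltnS => ml; rewrite !big_nat_recr//=.
have [P0 S0 le] := IH ml; have /andP[yl0 yl1] := y01 _ ml.
split; [by nra|by nra|].
apply: le_trans le; rewrite -mulrA ler_wpM2l//; nra.
Qed.

Lemma prod_one_add_le y m l : (forall i, (m <= i)%N -> 0 <= y i) ->
  \prod_(m <= i < l) (1 + y i) * (1 - \sum_(m <= i < l) y i) <= 1.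
Proof.
move=> y0; have [ml|lm] := leqP m l; last first.
  by rewrite !big_geq ?(ltnW lm)// subr0 mulr1.
suff [] : [/\ 0 <= \prod_(m <= i < l) (1 + y i), 0 <= \sum_(m <= i < l) y i &
  \prod_(m <= i < l) (1 + y i) * (1 - \sum_(m <= i < l) y i) <= 1] by [].
elim: l ml => [|l IH].
  by rewrite leqn0 => /eqP ->; rewrite !big_geq// subr0 mulr1.
rewrite leq_eqVlt => /orP[/eqP ->|]; first by rewrite !big_geq// subr0 mulr1.
rewrite ltnS => ml; rewrite !big_nat_recr//=.
have [P0 S0 le] := IH ml; have yl0 := y0 _ ml.
split; [by nra|by nra|].
apply: le_trans le; rewrite -mulrA ler_wpM2l//; nra.
Qed.

End ProductBounds.

(** * Histories and the duel martingale *)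

Section Histories.
Variables (R : realType) (f : nat -> R).
Hypothesis f_gt0 : forall n, 0 < f n.
Implicit Types (s : seq nat) (u v : nat) (phi : seq nat -> R).

(* A history [s] lists the parents of the nodes [1, ..., size s], so the nodes
   present are [0, ..., size s] and the degree of [u] is [count_mem u s]. *)
Definition attach_weight s j : R :=
  f (count_mem j s) / \sum_(i < (size s).+1) f (count_mem (val i) s).

Definition step_mean phi s : R :=
  \sum_(j < (size s).+1) attach_weight s (val j) * phi (rcons s (val j)).

Lemma count_mem_rcons u s j :
  count_mem u (rcons s j) = (count_mem u s + (j == u))%N.
Proof. by rewrite -cats1 count_cat /= addn0. Qed.

Lemma total_weight_gt0 s : 0 < \sum_(i < (size s).+1) f (count_mem (val i) s).
Proof.
rewrite big_ord_recl ltr_pwDl//; apply: sumr_ge0 => i _; exact: ltW.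
Qed.

Lemma attach_weight_ge0 s j : 0 <= attach_weight s j.
Proof. by rewrite divr_ge0 ?ltW// total_weight_gt0. Qed.

Lemma sum_attach_weight s : \sum_(j < (size s).+1) attach_weight s (val j) = 1.
Proof. by rewrite -mulr_suml divff// lt0r_neq0// total_weight_gt0. Qed.

Lemma step_meanD phi psi s :
  step_mean (fun t => phi t + psi t) s = step_mean phi s + step_mean psi s.
Proof. by rewrite -big_split; apply: eq_bigr => j _; rewrite mulrDr. Qed.

Lemma step_meanZ c phi s : step_mean (fun t => c * phi t) s = c * step_mean phi s.
Proof. by rewrite mulr_sumr; apply: eq_bigr => j _; rewrite mulrCA. Qed.

Lemma step_mean_cst c s : step_mean (fun=> c) s = c.
Proof. by rewrite /step_mean -mulr_suml sum_attach_weight mul1r. Qed.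

Lemma step_mean_pick c u s : (u <= size s)%N ->
  \sum_(j < (size s).+1) attach_weight s (val j) * ((j == u :> nat)%:R * c) =
  attach_weight s u * c.
Proof.
move=> us; rewrite (bigD1 (Ordinal (us : (u < (size s).+1)%N)))//= eqxx mul1r.
rewrite big1 ?addr0// => j /eqP ju; case: eqP => [e|_]; last by rewrite mul0r mulr0.
by case: ju; apply: val_inj.
Qed.

Definition duel lambda m k u v s : R :=
  (\prod_(m <= i < count_mem u s) (1 - lambda / f i)) *
  (\prod_(k <= i < count_mem v s) (1 + lambda / f i)).

Lemma step_mean_duel lambda m k u v s : u != v ->
  (u <= size s)%N -> (v <= size s)%N ->
  (m <= count_mem u s)%N -> (k <= count_mem v s)%N ->
  step_mean (duel lambda m k u v) s = duel lambda m k u v s.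
Proof.
move=> uv us vs mu kv; set H := duel _ _ _ _ _ s.
have E j : duel lambda m k u v (rcons s j) = H
    + (j == u)%:R * (- (H * (lambda / f (count_mem u s))))
    + (j == v)%:R * (H * (lambda / f (count_mem v s))).
  rewrite /H /duel !count_mem_rcons.
  have [ju|ju] := eqVneq j u.
    rewrite -ju in uv; rewrite (negPf uv) addn1 addn0 big_nat_recr//=; ring.
  have [jv|jv] := eqVneq j v.
    rewrite addn1 addn0 big_nat_recr//=; ring.
  by rewrite !addn0 !mul0r !addr0.
transitivity (\sum_(j < (size s).+1) (attach_weight s (val j) * H
    + attach_weight s (val j) * ((j == u :> nat)%:R * (- (H * (lambda / f (count_mem u s)))))
    + attach_weight s (val j) * ((j == v :> nat)%:R * (H * (lambda / f (count_mem v s)))))).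
  by apply: eq_bigr => j _; rewrite E !mulrDr.
rewrite 2!big_split/= !step_mean_pick// -mulr_suml sum_attach_weight mul1r.
have Z := total_weight_gt0 s; rewrite /attach_weight.
field; by rewrite !lt0r_neq0.
Qed.

Definition hist_maxdeg s : nat := \max_(v < (size s).+1) count_mem (val v) s.

Lemma leq_hist_maxdeg u s : (u <= size s)%N -> (count_mem u s <= hist_maxdeg s)%N.
Proof.
move=> us.
exact: (@leq_bigmax _ (fun v : 'I_(size s).+1 => count_mem (val v) s) (Ordinal (us : (u < _.+1)%N))).
Qed.

Definition leader s : nat :=
  [arg max_(v > @ord0 (size s)) count_mem (val v) s].

Lemma leader_le s : (leader s <= size s)%N.
Proof. by rewrite -ltnS ltn_ord. Qed.

Lemma count_mem_leader s : count_mem (leader s) s = hist_maxdeg s.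
Proof.
apply/eqP; rewrite eqn_leq leq_hist_maxdeg ?leader_le//=.
rewrite /leader; case: arg_maxnP => //= i _ h.
by apply/bigmax_leqP => j _; exact: h.
Qed.

Lemma hist_maxdeg_rcons s j : (hist_maxdeg s <= hist_maxdeg (rcons s j))%N.
Proof.
rewrite -(count_mem_leader s); apply: leq_trans (@leq_hist_maxdeg (leader s) _ _).
  by rewrite count_mem_rcons leq_addr.
by rewrite size_rcons (leq_trans (leader_le s)).
Qed.

Lemma hist_maxdeg_rcons_leader s :
  (hist_maxdeg s < hist_maxdeg (rcons s (leader s)))%N.
Proof.
rewrite -{1}(count_mem_leader s); apply: leq_trans (@leq_hist_maxdeg (leader s) _ _).
  by rewrite count_mem_rcons eqxx addn1.
by rewrite size_rcons (leq_trans (leader_le s)).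
Qed.

Lemma sum_count_mem_le n s : (\sum_(j < n) count_mem (val j) s <= size s)%N.
Proof.
elim: s => [|x s IH] /=; first by rewrite big1.
rewrite big_split /= -add1n leq_add//.
have [xn|nx] := ltnP x n.
  rewrite (bigD1 (Ordinal xn))//= eqxx big1 ?addn0// => i /eqP ix.
  by case: eqP => // e; case: ix; apply: val_inj.
rewrite big1// => i _; case: eqP => // e.
by move: (ltn_ord i); rewrite -e ltnNge nx.
Qed.

End Histories.

Section Growth.
Variable R : realType.

Definition growth (c : R) n : R := \prod_(0 <= i < n) (1 + c / i.+1%:R).

Lemma growth0 c : growth c 0 = 1.
Proof. by rewrite /growth big_geq. Qed.

Lemma growthS c n : growth c n.+1 = growth c n * (1 + c / n.+1%:R).
Proof. by rewrite /growth big_nat_recr. Qed.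

Lemma growth_gt0 c n : 0 <= c -> 0 < growth c n.
Proof.
move=> c0; elim: n => [|n IH]; first by rewrite growth0.
by rewrite growthS mulr_gt0// ltr_pwDl// divr_ge0.
Qed.

Lemma growth_le c m n : 0 <= c -> (m <= n)%N -> growth c m <= growth c n.
Proof.
move=> c0 /subnK <-; elim: (n - m)%N => [//|k IH].
rewrite addSn growthS (le_trans IH)// ler_peMr ?lerDl ?divr_ge0//.
exact/ltW/growth_gt0.
Qed.

Lemma growth2 n : growth 2 n = n.+1%:R * n.+2%:R / 2.
Proof.
elim: n => [|n IH]; first by rewrite growth0 mul1r divff.
by rewrite growthS IH -!natr1; field; rewrite natr1.
Qed.

Lemma growth_unbounded c b : 0 < c -> exists n, b < growth c n.
Proof.
move=> c0; pose q := (Num.trunc c^-1).+1; have cq : 1 <= c * q%:R.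
  by rewrite -ler_pdivrMl// mulr1 ltW// truncnS_gt.
have bern x k : 0 <= x -> 1 + k%:R * x <= (1 + x) ^+ k :> R.
  move=> x0; elim: k => [|k IH]; first by rewrite mul0r addr0.
  rewrite exprS -natr1; have k0 : 0 <= k%:R :> R by [].
  by apply: (@le_trans _ _ ((1 + x) * (1 + k%:R * x))); [nra|rewrite ler_wpM2l// addr_ge0].
have gq n : n.+1%:R <= growth c n ^+ q.
  elim: n => [|n IH]; first by rewrite growth0 expr1n.
  have n0 : 0 < n.+1%:R :> R by [].
  rewrite growthS exprMn; apply: (@le_trans _ _ (n.+1%:R * (1 + q%:R * (c / n.+1%:R)))).
    rewrite [leRHS](_ : _ = n.+1%:R + c * q%:R); last by field; rewrite ?natr1 lt0r_neq0.
    by rewrite -[n.+2%:R]natr1 lerD2l.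
  by rewrite ler_pM ?bern ?divr_ge0 ?addr_ge0 ?mulr_ge0// ?(ltW c0)// divr_ge0// ltW.
pose n := Num.trunc (`|b| ^+ q); exists n.
rewrite (le_lt_trans (ler_norm b))// -(@ltr_pXn2r _ q)// ?nnegrE ?normr_ge0//.
  by rewrite (lt_le_trans _ (gq n))// truncnS_gt.
exact/ltW/growth_gt0/ltW.
Qed.

End Growth.

(** * Consequences of the growth condition *)

Section QuasiMonotone.
Variables (R : realType) (f : nat -> R) (kappa : R).
Hypothesis f_gt0 : forall n, 0 < f n.
Hypothesis kappa_gt0 : 0 < kappa.
Hypothesis f_quasi : forall n i, (i <= n)%N ->
  f i / i.+1%:R <= kappa * (f n / n.+1%:R).

Lemma kappa_ge1 : 1 <= kappa.
Proof. by have := f_quasi (leqnn 0); rewrite divr1 ler_pMl. Qed.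

Lemma f_le_kappa i n : (i <= n)%N -> f i <= kappa * f n.
Proof.
move=> le; have := f_quasi le; rewrite ler_pdivrMr// => /le_trans; apply.
rewrite -mulrA ler_wpM2l ?(ltW kappa_gt0)// mulrAC ler_pdivrMr//.
by rewrite ler_wpM2l ?ler_nat// ltW.
Qed.

Lemma leader_weight_ge s :
  (hist_maxdeg s).+1%:R / (2 * kappa * (size s).+1%:R) <= attach_weight f s (leader s).
Proof.
rewrite /attach_weight count_mem_leader; set m := hist_maxdeg s; set n := size s.
rewrite ler_pdivrMr ?mulr_gt0// mulrAC ler_pdivlMr ?total_weight_gt0//.
rewrite mulr_sumr; apply: (@le_trans _ _
    (\sum_(i < n.+1) kappa * f m * ((count_mem (val i) s)%:R + 1))).
  apply: ler_sum => i _; have im : (count_mem (val i) s <= m)%N.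
    by apply: leq_hist_maxdeg; rewrite -ltnS ltn_ord.
  have := f_quasi im; rewrite ler_pdivrMr// => h.
  rewrite natr1 mulrC (le_trans (ler_wpM2r _ h))//.
  by rewrite le_eqVlt; apply/orP; left; apply/eqP; field; rewrite ?nat1r ?natr1 pnatr_eq0.
rewrite -mulr_sumr big_split/= sumr_const card_ord -natr_sum.
rewrite [X in _ <= X](_ : _ = kappa * f m * (n.+1%:R + n.+1%:R)); last by ring.
rewrite ler_wpM2l ?mulr_ge0 ?(ltW kappa_gt0) ?(ltW (f_gt0 _))//. rewrite lerD2r ler_nat.
by rewrite (leq_trans (sum_count_mem_le _ _)).
Qed.

Lemma step_mean_inv_growth (p c : R) s : 0 <= p ->
  c * (2 * kappa) * ((hist_maxdeg s).+1%:R + p) <= p * (hist_maxdeg s).+1%:R ->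
  step_mean f (fun t => (growth p (hist_maxdeg t))^-1) s <=
    (1 - c / (size s).+1%:R) * (growth p (hist_maxdeg s))^-1.
Proof.
move=> p0 hc; set m := hist_maxdeg s in hc *; set g := growth p m.
have g0 : 0 < g by exact: growth_gt0.
have m1 : 0 < m.+1%:R :> R by [].
have mp : 0 < m.+1%:R + p by rewrite ltr_wpDr.
have E j : (growth p (hist_maxdeg (rcons s j)))^-1 <=
    g^-1 + (j == leader s)%:R * (- (g^-1 * (p / (m.+1%:R + p)))).
  have [->|_] := eqVneq j (leader s).
    apply: (@le_trans _ _ (growth p m.+1)^-1).
      rewrite lef_pV2 ?posrE ?growth_gt0// growth_le//.
      exact: hist_maxdeg_rcons_leader.
    rewrite mul1r growthS -/g le_eqVlt; apply/orP; left; apply/eqP.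
    by field; rewrite ?nat1r ?natr1 !lt0r_neq0.
  rewrite mul0r addr0 lef_pV2 ?posrE ?growth_gt0// growth_le//.
  exact: hist_maxdeg_rcons.
have L := leader_weight_ge s; rewrite -/m in L.
apply: (@le_trans _ _ (\sum_(j < (size s).+1) (attach_weight f s (val j) * g^-1
    + attach_weight f s (val j) * ((j == leader s :> nat)%:R *
        (- (g^-1 * (p / (m.+1%:R + p)))))))).
  apply: ler_sum => j _; rewrite -mulrDr ler_wpM2l ?E// attach_weight_ge0//.
rewrite big_split/= step_mean_pick ?leader_le// -mulr_suml sum_attach_weight// mul1r.
rewrite mulrN mulrBl mul1r lerD2l lerN2 mulrCA [leLHS]mulrC ler_wpM2l ?invr_ge0 ?(ltW g0)//.
have n0 : 0 < (size s).+1%:R :> R by [].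
apply: le_trans (ler_wpM2r _ L); last by rewrite divr_ge0// ltW.
rewrite mulf_div ler_pdivlMr ?mulr_gt0// [leLHS](_ : _ =
  c * (2 * kappa) * (m.+1%:R + p)); last by field; rewrite ?nat1r ?natr1 lt0r_neq0.
by rewrite [leRHS]mulrC.
Qed.

Lemma overtake_duel (p lambda : R) m a b : lambda = kappa * p * (f m / m.+1%:R) ->
  0 <= p -> (0 < m)%N ->
  2 * (kappa ^+ 2 * p) ^+ 2 <= m%:R -> (m <= a <= b)%N ->
  growth p m / 2 <= (\prod_(m <= i < a) (1 - lambda / f i)) *
                     \prod_(0 <= i < b) (1 + lambda / f i).
Proof.
move=> lambdaE p0 m0 mbig /andP[ma ab].
have lambda0 : 0 <= lambda by rewrite lambdaE !mulr_ge0// ltW.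
pose x i := lambda / f i; have x0 i : 0 <= x i by rewrite divr_ge0// ltW.
have x_hi i : (m <= i)%N -> x i <= kappa ^+ 2 * p / i.+1%:R.
  move=> mi; rewrite /x ler_pdivrMr//.
  rewrite [leRHS](_ : _ = kappa * p * (kappa * (f i / i.+1%:R))); last by ring.
  by rewrite lambdaE ler_wpM2l ?f_quasi// mulr_ge0// ltW.
have x_lo i : (i <= m)%N -> p / i.+1%:R <= x i.
  move=> im; rewrite /x ler_pdivlMr// mulrAC -mulrA lambdaE [kappa * p]mulrC -mulrA.
  by rewrite ler_wpM2l// f_quasi.
have x2 i : (m <= i)%N -> x i ^+ 2 <= (kappa ^+ 2 * p) ^+ 2 * (i.+1%:R ^+ 2)^-1.
  move=> mi; rewrite -exprVn -exprMn lerXn2r ?nnegrE ?x_hi//.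
  by rewrite !mulr_ge0 ?exprn_ge0 ?invr_ge0// ltW.
have sum2 l : \sum_(m <= i < l) x i ^+ 2 <= 2^-1.
  apply: (@le_trans _ _ (\sum_(m <= i < l) (kappa ^+ 2 * p) ^+ 2 * (i.+1%:R ^+ 2)^-1)).
    by rewrite !big_nat; apply: ler_sum => i /andP[mi _]; exact: x2.
  rewrite -mulr_sumr (le_trans (ler_wpM2l _ (sum_inv_sqr_le _ _ m0)))// ?sqr_ge0//.
  by rewrite ler_pdivrMr ?ltr0n// ler_pdivlMl.
have x21 i : (m <= i)%N -> 0 <= x i ^+ 2 <= 1.
  move=> mi; rewrite sqr_ge0/=; have := sum2 i.+1; rewrite big_nat_recr//=.
  have : 0 <= \sum_(m <= i < i) x i ^+ 2 by apply: sumr_ge0 => k _; exact: sqr_ge0.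
  lra.
have half : 2^-1 <= \prod_(m <= i < a) (1 - x i ^+ 2).
  apply: le_trans (prod_one_sub_ge a x21); have := sum2 a; lra.
have posP k l : 0 <= \prod_(k <= i < l) (1 + x i).
  by apply: prodr_ge0 => i _; rewrite addr_ge0.
have posM l : 0 <= \prod_(m <= i < l) (1 - x i).
  rewrite big_nat prodr_ge0// => i /andP[/x21/andP[_ h] _].
  by have := x0 i; nra.
apply: (@le_trans _ _ (\prod_(m <= i < a) (1 - x i) * \prod_(0 <= i < a) (1 + x i))).
  rewrite [\prod_(0 <= i < a) _](big_cat_nat (n := m) _ ma)//= mulrCA.
  rewrite (_ : _ * \prod_(m <= i < a) (1 + x i) = \prod_(m <= i < a) (1 - x i ^+ 2)); last first.
    by rewrite -big_split; apply: eq_bigr => i _ /=; ring.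
  apply: ler_pM => //; first exact/ltW/growth_gt0.
  rewrite /growth !big_nat; apply: ler_prod => i /andP[_ im].
  by rewrite addr_ge0 ?divr_ge0//= lerD2l x_lo// ltnW.
rewrite ler_wpM2l// [\prod_(0 <= i < b) _](big_cat_nat (n := a) _ ab)//= ler_peMr//.
rewrite big_nat; elim/big_ind : _ => // [y z h1 h2|i _]; first by nra.
by rewrite lerDl; exact: x0.
Qed.

Lemma tie_scale k : (0 < k)%N -> exists lambda K,
  [/\ forall i, (k <= i)%N -> 0 <= lambda / f i <= 4^-1,
      forall l, \sum_(k <= i < l) (lambda / f i) ^+ 2 <= 16^-1 &
      forall l, (K <= l)%N ->
        (32 * kappa ^+ 2)^-1 <= \sum_(k <= i < l) (lambda / f i) ^+ 2].
Proof.
move=> k0; pose V l := \sum_(k <= i < l) (f i)^-2.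
have V_homo l l' : (l <= l')%N -> V l <= V l'.
  move=> ll'; have [kl|lk] := leqP k l; last first.
    rewrite {1}/V big_geq ?(ltnW lk)//; apply: sumr_ge0 => i _.
    by rewrite invr_ge0 exprn_ge0// ltW.
  rewrite /V (big_cat_nat (n := l) _ ll')//= lerDl; apply: sumr_ge0 => i _.
  by rewrite invr_ge0 exprn_ge0// ltW.
have V_bnd l : V l <= kappa ^+ 2 * k.+1%:R ^+ 2 / f k ^+ 2.
  apply: (@le_trans _ _ (\sum_(k <= i < l)
      kappa ^+ 2 * k.+1%:R ^+ 2 / f k ^+ 2 * (i.+1%:R ^+ 2)^-1)).
    rewrite /V !big_nat; apply: ler_sum => i /andP[ki _].
    rewrite [leRHS](_ : _ = (kappa * k.+1%:R / f k / i.+1%:R) ^+ 2); last first.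
      by field; rewrite ?nat1r ?natr1 !pnatr_eq0 lt0r_neq0.
    rewrite -exprVn lerXn2r ?nnegrE ?divr_ge0 ?mulr_ge0 ?invr_ge0// ?(ltW kappa_gt0) ?(ltW (f_gt0 _))//.
    have := f_quasi ki; rewrite ler_pdivrMr// => h.
    rewrite -(ler_pM2r (f_gt0 k)) -(ler_pM2r (f_gt0 i)) mulrAC mulVf ?lt0r_neq0// mul1r.
    apply: (le_trans h); rewrite le_eqVlt; apply/orP; left; apply/eqP.
    by field; rewrite ?nat1r ?natr1 !pnatr_eq0 lt0r_neq0.
  rewrite -mulr_sumr ler_piMr ?divr_ge0 ?mulr_ge0 ?exprn_ge0// ?(ltW kappa_gt0) ?(ltW (f_gt0 _))//.
  apply: (le_trans (sum_inv_sqr_le _ _ k0)).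
  by rewrite invf_le1 ?ltr0n// ler1n.
have supV : has_sup (range V).
  split; first by exists (V 0); exists 0.
  by exists (kappa ^+ 2 * k.+1%:R ^+ 2 / f k ^+ 2) => _ [l _ <-].
pose S := sup (range V).
have VS l : V l <= S by apply: sup_upper_bound => //; exists l.
have S_ge : (f k)^-2 <= S by have := VS k.+1; rewrite /V big_nat1.
have S0 : 0 < S by apply: lt_le_trans S_ge; rewrite invr_gt0 exprn_gt0.
have [_ [K _ <-]] := sup_adherent (divr_gt0 S0 (ltr0Sn R 1)) supV; rewrite -/S => SK.
pose lambda := (4 * kappa * Num.sqrt S)^-1.
have lambda2 : lambda ^+ 2 = (16 * kappa ^+ 2 * S)^-1.
  rewrite /lambda exprVn !exprMn sqr_sqrtr ?(ltW S0)//; congr (_ * _ * _)^-1; ring.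
have sumE l : \sum_(k <= i < l) (lambda / f i) ^+ 2 = (16 * kappa ^+ 2)^-1 * (V l / S).
  rewrite /V mulrA mulrAC mulr_sumr; apply: eq_bigr => i _.
  rewrite exprMn lambda2 exprVn; field.
  by rewrite !lt0r_neq0.
have k1 := kappa_ge1; have k2 : 1 <= kappa ^+ 2 by rewrite exprn_ege1.
exists lambda, K; split.
- move=> i ki; have l0 : 0 <= lambda by rewrite invr_ge0 !mulr_ge0 ?sqrtr_ge0// ltW.
  rewrite divr_ge0//= ?(ltW (f_gt0 _))// ler_pdivrMr//.
  rewrite -(@ler_pXn2r _ 2)// ?nnegrE ?mulr_ge0 ?(ltW (f_gt0 _))//.
  rewrite lambda2 invf_ple ?posrE ?exprn_gt0 ?mulr_gt0 ?exprn_gt0//.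
  have fk := f_le_kappa ki.
  have : (kappa * f i)^-2 <= S.
    apply: le_trans S_ge; rewrite lef_pV2 ?posrE ?exprn_gt0 ?mulr_gt0//.
    by rewrite lerXn2r ?nnegrE ?mulr_ge0 ?(ltW (f_gt0 _)) ?(ltW kappa_gt0).
  rewrite -(ler_pM2l (_ : 0 < 16 * kappa ^+ 2)) ?mulr_gt0 ?exprn_gt0//.
  apply: le_trans; rewrite le_eqVlt; apply/orP; left; apply/eqP.
  by field; rewrite !lt0r_neq0.
- move=> l; rewrite sumE.
  apply: (@le_trans _ _ (16 * kappa ^+ 2)^-1).
    rewrite ler_piMr ?invr_ge0 ?mulr_ge0 ?exprn_ge0 ?(ltW kappa_gt0)//.
    by rewrite ler_pdivrMr// mul1r.
  rewrite lef_pV2 ?posrE ?mulr_gt0 ?exprn_gt0//; lra.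
move=> l Kl; rewrite sumE.
have : 2^-1 <= V l / S.
  rewrite ler_pdivlMr//; have := V_homo _ _ Kl; lra.
rewrite -(ler_pM2l (_ : 0 < (16 * kappa ^+ 2)^-1)) ?invr_gt0 ?mulr_gt0 ?exprn_gt0//.
by apply: le_trans; rewrite -invfM (_ : 16 * kappa ^+ 2 * 2 = 32 * kappa ^+ 2)//; ring.
Qed.

(* Nonnegative because [duel lambda ^ 2 <= 2 * duel (2 * lambda)]; at late ties it
   exceeds its value at the initial tie, where both duels equal [1]. *)
Definition tie_potential (lambda B : R) k u v s : R :=
  B ^+ 2 / 2 + (duel f (2 * lambda) k k u v s - B * duel f lambda k k u v s).

Lemma step_mean_tie_potential lambda B k u v s : u != v ->
  (u <= size s)%N -> (v <= size s)%N ->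
  (k <= count_mem u s)%N -> (k <= count_mem v s)%N ->
  step_mean f (tie_potential lambda B k u v) s = tie_potential lambda B k u v s.
Proof.
move=> uv us vs ku kv; rewrite /tie_potential step_meanD step_mean_cst//; congr (_ + _).
under [in LHS]eq_fun do rewrite -mulNr.
by rewrite step_meanD step_meanZ !step_mean_duel// mulNr.
Qed.

Section TieScale.
Variables (lambda : R) (k : nat).
Hypothesis quarter : forall i, (k <= i)%N -> 0 <= lambda / f i <= 4^-1.
Hypothesis sum_sqr : forall l, \sum_(k <= i < l) (lambda / f i) ^+ 2 <= 16^-1.

Lemma duel_sqr_le u v s :
  duel f lambda k k u v s ^+ 2 <= 2 * duel f (2 * lambda) k k u v s.
Proof.
pose x i := lambda / f i; have xq : forall i, (k <= i)%N -> 0 <= x i <= 4^-1 := quarter.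
have sx : forall l, \sum_(k <= i < l) x i ^+ 2 <= 16^-1 := sum_sqr.
rewrite /duel; set a := count_mem u s; set b := count_mem v s.
pose P l := \prod_(k <= i < l) (1 + 2 * x i ^+ 2).
have P0 l : 0 <= P l by apply: prodr_ge0 => i _; apply: addr_ge0 => //; apply: mulr_ge0 => //; exact: sqr_ge0.
have P1 l : P l <= 8 / 7.
  have y0 i : (k <= i)%N -> 0 <= 2 * x i ^+ 2.
    by move=> _; apply: mulr_ge0 => //; exact: sqr_ge0.
  have := prod_one_add_le l y0; rewrite -/(P l) -mulr_sumr; have := sx l.
  by have := P0 l; nra.
pose D c l := \prod_(k <= i < l) (1 + c * x i).
have D0 c l : -2 <= c -> 0 <= D c l.
  move=> c2; rewrite /D big_nat prodr_ge0// => i /andP[/xq ? _]; nra.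
have D2 c l : -1 <= c <= 1 -> D c l ^+ 2 <= D (2 * c) l * P l.
  move=> c1; rewrite /D /P expr2 -!big_split/= !big_nat; apply: ler_prod => i /andP[/xq xi _].
  rewrite -expr2 sqr_ge0/=; case/andP: xi; set y := x i => y0 y4.
  rewrite -subr_ge0 (_ : _ - _ = y ^+ 2 * (2 + 4 * c * y - c ^+ 2)); last by ring.
  by rewrite mulr_ge0 ?sqr_ge0//; nra.
have -> : \prod_(k <= i < a) (1 - lambda / f i) = D (-1) a.
  by apply: eq_bigr => i _; rewrite mulN1r.
have -> : \prod_(k <= i < b) (1 + lambda / f i) = D 1 b.
  by apply: eq_bigr => i _; rewrite mul1r.
have -> : \prod_(k <= i < a) (1 - 2 * lambda / f i) = D (2 * -1) a.
  by apply: eq_bigr => i _; rewrite mulrN1 mulNr mulrA.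
have -> : \prod_(k <= i < b) (1 + 2 * lambda / f i) = D (2 * 1) b.
  by apply: eq_bigr => i _; rewrite mulr1 mulrA.
rewrite exprMn.
have h1 : D (-1) a ^+ 2 <= D (2 * -1) a * P a by apply: D2; lra.
have h2 : D 1 b ^+ 2 <= D (2 * 1) b * P b by apply: D2; lra.
apply: (le_trans (ler_pM (sqr_ge0 _) (sqr_ge0 _) h1 h2)).
rewrite mulrACA mulrC ler_wpM2r ?mulr_ge0//; [by apply: D0; lra|by apply: D0; lra|].
have := P1 a; have := P1 b; have := P0 a; have := P0 b; nra.
Qed.

Lemma tie_potential_ge0 B u v s : 0 <= tie_potential lambda B k u v s.
Proof.
rewrite /tie_potential; have := duel_sqr_le u v s.
set H := duel _ lambda _ _ _ _ _; set G := duel _ _ _ _ _ _ _ => HG.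
have := sqr_ge0 (B - H); nra.
Qed.

Lemma tie_potential_start B u v s : count_mem u s = k -> count_mem v s = k ->
  tie_potential lambda B k u v s = B ^+ 2 / 2 + (1 - B).
Proof. by move=> uk vk; rewrite /tie_potential /duel uk vk !big_geq// !mulr1. Qed.

Lemma tie_potential_tie B u v s q : count_mem u s = count_mem v s ->
  q <= \sum_(k <= i < count_mem u s) (lambda / f i) ^+ 2 -> 0 <= q -> 4 <= B * q ->
  B ^+ 2 / 2 + (1 - B) + 1 <= tie_potential lambda B k u v s.
Proof.
move=> uv qS q0 Bq; rewrite /tie_potential -addrA lerD2l /duel -uv.
pose x i := lambda / f i; have xq : forall i, (k <= i)%N -> 0 <= x i <= 4^-1 := quarter.
rewrite -!big_split/=.
have -> : \prod_(k <= i < count_mem u s) ((1 - lambda / f i) * (1 + lambda / f i)) =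
    \prod_(k <= i < count_mem u s) (1 - x i ^+ 2).
  by apply: eq_bigr => i _; rewrite -/(x i); ring.
have G0 : 0 <= \prod_(k <= i < count_mem u s) ((1 - 2 * lambda / f i) * (1 + 2 * lambda / f i)).
  rewrite big_nat prodr_ge0// => i /andP[/xq xi _].
  by rewrite -mulrA -/(x i); apply: mulr_ge0; lra.
have x21 i : (k <= i)%N -> 0 <= x i ^+ 2 <= 1 by move=> /xq xi; nra.
have := prod_one_sub_le (count_mem u s) x21.
have := sum_sqr (count_mem u s); move: qS; rewrite -/(x _).
set S := \sum_(_ <= _ < _) _; set D := \prod_(_ <= _ < _) _ => qS S16 DS.
have B0 : 0 < B by nra.
have D2 : D <= 1 - S / 2.
  rewrite -(ler_pM2r (_ : 0 < 1 + S)); last by lra.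
  by apply: (le_trans DS); nra.
have : B * D <= B * (1 - q / 2) by rewrite ler_pM2l//; lra.
move: G0; set G := \prod_(_ <= _ < _) _; nra.
Qed.

End TieScale.
End QuasiMonotone.

Local Open Scope classical_set_scope.

(** * Cylinders and hitting probabilities *)

Section RealProbability.
Context {d : measure_display} {T : measurableType d} {R : realType}.
Variable P : probability T R.
Implicit Types (A B : set T) (F : nat -> set T).

Definition pr A : R := fine (P A).

Lemma prE A : measurable A -> P A = (pr A)%:E.
Proof. by move=> mA; rewrite fineK// fin_num_measure. Qed.

Lemma pr_ge0 A : 0 <= pr A.
Proof. exact/fine_ge0/measure_ge0. Qed.

Lemma pr_set0 : pr set0 = 0.
Proof. by rewrite /pr measure0. Qed.

Lemma pr_le A B : measurable A -> measurable B -> A `<=` B -> pr A <= pr B.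
Proof.
by move=> mA mB AB; rewrite -lee_fin -!prE// le_measure ?inE.
Qed.

Lemma pr_bigcup_le F c : (forall n, measurable (F n)) ->
  {homo F : m n / (m <= n)%N >-> m `<=` n} -> (forall n, pr (F n) <= c) ->
  pr (\bigcup_n F n) <= c.
Proof.
move=> mF homF Fc; have mU : measurable (\bigcup_n F n) by exact: bigcupT_measurable.
have homF' : {homo F : m n / (m <= n)%N >-> (m <= n)%O}.
  by move=> m n /homF/subsetPset.
rewrite -lee_fin -prE//; apply: cvge_le (nondecreasing_cvg_mu mF mU homF').
by apply: nearW => n; rewrite /= prE// lee_fin.
Qed.

Lemma pr_bigcap_ge F c : (forall n, measurable (F n)) ->
  {homo F : m n / (m <= n)%N >-> n `<=` m} -> (forall n, c <= pr (F n)) ->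
  c <= pr (\bigcap_n F n).
Proof.
move=> mF homF Fc; have mU : measurable (\bigcap_n F n) by exact: bigcapT_measurable.
have homF' : {homo F : m n / (m <= n)%N >-> (n <= m)%O}.
  by move=> m n /homF/subsetPset.
have fin0 : (P (F 0%N) < +oo)%E by rewrite prE// ltry.
rewrite -lee_fin -prE//; apply: cvge_ge (nonincreasing_cvg_mu fin0 mF mU homF').
by apply: nearW => n; rewrite /= prE// lee_fin.
Qed.

Lemma pr_eq0_negligible A : measurable A -> pr A = 0 -> P.-negligible A.
Proof. by move=> mA A0; exists A; split => //; rewrite prE// A0. Qed.

End RealProbability.

Section Cylinders.
Context {d : measure_display} {T : measurableType d} {R : realType}.
Variables (P : probability T R) (f : nat -> R) (J : nat -> T -> nat).
Hypothesis GPA : is_GPA_tree P f J.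
Implicit Types (s : seq nat) (n : nat) (B Inv : seq nat -> Prop) (A X : set T).

Definition hist n w : seq nat := mkseq (J^~ w) n.

Lemma size_hist n w : size (hist n w) = n.
Proof. exact: size_mkseq. Qed.

Lemma histS n w : hist n.+1 w = rcons (hist n w) (J n w).
Proof. exact: mkseqS. Qed.

Definition cyl s : set T := [set w | hist (size s) w = s].

Lemma cyl_hist n w : cyl (hist n w) w.
Proof. by rewrite /cyl/= size_hist. Qed.

Lemma cyl_nil : cyl [::] = setT.
Proof. by apply/seteqP; split. Qed.

Lemma cyl_rcons s j : cyl (rcons s j) = cyl s `&` [set w | J (size s) w = j].
Proof.
apply/seteqP; split => w; rewrite /cyl/= size_rcons histS.
  by move=> /eqP; rewrite eqseq_rcons => /andP[/eqP ? /eqP ?].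
by move=> [-> ->].
Qed.

Lemma measurable_J k j : measurable [set w | J k w = j].
Proof. by case: GPA => + _; apply. Qed.

Lemma measurable_cyl s : measurable (cyl s).
Proof.
elim/last_ind: s => [|s j IH]; first by rewrite cyl_nil.
by rewrite cyl_rcons; apply: measurableI => //; exact: measurable_J.
Qed.

Lemma measurable_hist B n : measurable [set w | B (hist n w)].
Proof.
have -> : [set w | B (hist n w)] =
    \bigcup_s (cyl s `&` [set w | size s = n /\ B s]).
  apply/seteqP; split => [w Bw|w [s _ [/= sw [sn Bs]]]].
    by exists (hist n w) => //; split; [exact: cyl_hist|rewrite /= size_hist].
  by rewrite /= -sn sw.
apply: countable_bigcupT_measurable; first exact: countableP.
move=> s; apply: measurableI; first exact: measurable_cyl.
have [h|h] := pselect (size s = n /\ B s).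
  by rewrite (_ : [set _ | _] = setT)//; apply/seteqP; split.
by rewrite (_ : [set _ | _] = set0)//; apply/seteqP; split.
Qed.

Lemma outdegE (t : nat -> nat) n u : outdeg t n u = count_mem u (mkseq t n).
Proof. by rewrite /mkseq count_map. Qed.

Lemma pa_stepE (t : nat -> nat) k :
  pa_step f t k = if (t k <= k)%N then attach_weight f (mkseq t k) (t k) else 0.
Proof.
rewrite /pa_step /attach_weight size_mkseq outdegE; case: ifP => // _.
by congr (_ / _); apply: eq_bigr => i _; rewrite outdegE.
Qed.

Lemma eq_pa_step (t t' : nat -> nat) k : (forall i, (i <= k)%N -> t i = t' i) ->
  pa_step f t k = pa_step f t' k.
Proof.
move=> tt'; rewrite !pa_stepE tt'//; suff -> : mkseq t k = mkseq t' k by [].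
apply/eq_in_map => i; rewrite mem_iota/= add0n => ik.
by rewrite tt'// ltnW.
Qed.

Lemma pr_cyl s : pr P (cyl s) = \prod_(k < size s) pa_step f (nth 0%N s) k.
Proof.
have [_ /(_ (size s) (nth 0%N s))] := GPA; rewrite /pr.
suff -> : cyl s = [set w | forall k, (k < size s)%N -> J k w = nth 0%N s k] by move=> ->.
apply/seteqP; split => w /=.
  by rewrite /cyl/= => <- k; rewrite size_hist => kn; rewrite nth_mkseq.
move=> sw; rewrite /cyl/=; apply: (@eq_from_nth _ 0%N); rewrite size_hist// => k ks.
by rewrite nth_mkseq// sw.
Qed.

Lemma pr_cyl_rcons s j : pr P (cyl (rcons s j)) =
  pr P (cyl s) * (if (j <= size s)%N then attach_weight f s j else 0).
Proof.
rewrite !pr_cyl size_rcons big_ord_recr/=; congr (_ * _).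
  apply: eq_bigr => k _; apply: eq_pa_step => i ik.
  by rewrite nth_rcons (leq_ltn_trans ik).
rewrite pa_stepE nth_rcons ltnn eqxx; case: ifP => // _; congr attach_weight.
apply: (@eq_from_nth _ 0%N); rewrite size_mkseq// => k ks.
by rewrite nth_mkseq// nth_rcons ks.
Qed.

Lemma pr_cyl_step phi s :
  \sum_(j < (size s).+1) phi (rcons s (val j)) * pr P (cyl (rcons s (val j))) =
  step_mean f phi s * pr P (cyl s).
Proof.
rewrite mulr_suml; apply: eq_bigr => j _; rewrite pr_cyl_rcons.
have -> : (val j <= size s)%N by rewrite -ltnS; exact: ltn_ord.
by ring.
Qed.

Lemma pr_cyl_split X s : measurable X ->
  pr P (X `&` cyl s) = \sum_(j < (size s).+1) pr P (X `&` cyl (rcons s (val j))).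
Proof.
move=> mX; set n := size s.
pose F j := X `&` cyl (rcons s j).
have mF j : measurable (F j) by apply: measurableI => //; exact: measurable_cyl.
have tF : trivIset setT F.
  apply/trivIsetP => i j _ _ /eqP ij; apply/seteqP; split => // w.
  by rewrite /F !cyl_rcons => -[[_ [_ /= Ji]] [_ [_ /= Jj]]]; case: ij; rewrite -Ji.
pose V := \bigcup_j F (n.+1 + j)%N.
have mV : measurable V by exact: bigcupT_measurable.
have PV : P V = 0%E.
  apply: measure_negligible => //; apply: negligible_bigcup => j.
  apply: (@negligibleS _ _ _ _ (cyl (rcons s (n.+1 + j)))); first by move=> w [].
  apply: pr_eq0_negligible; first exact: measurable_cyl.
  by rewrite pr_cyl_rcons leqNgt ltnS leq_addr/= mulr0.
have mU : measurable (\big[setU/set0]_(j < n.+1) F j) by exact: bigsetU_measurable.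
have -> : X `&` cyl s = \big[setU/set0]_(j < n.+1) F j `|` V.
  apply/seteqP; split => w.
    move=> [Xw sw]; have [Jn|Jn] := leqP (J n w) n.
      left; rewrite -bigcup_mkord; exists (J n w) => //.
      by split => //; rewrite cyl_rcons.
    right; exists (J n w - n.+1)%N => //; rewrite subnKC//.
    by split => //; rewrite cyl_rcons.
  case; first rewrite -bigcup_mkord.
    by move=> [j _ [Xw]]; rewrite cyl_rcons => -[sw _].
  by move=> [j _ [Xw]]; rewrite cyl_rcons => -[sw _].
set U := \big[setU/set0]_(j < n.+1) F j in mU *.
have UV0 : U `&` V = set0.
  apply/seteqP; split => // w [+ [j _]]; rewrite /U -bigcup_mkord => -[i /= ilt].
  rewrite /F !cyl_rcons => -[_ [_ /= Ji]] [_ [_ /= Jj]].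
  by move: ilt; rewrite -Ji Jj -/n ltnNge ltnS leq_addr.
have PU : P (U `|` V) = P U.
  by have /= -> := measureU P mU mV UV0; rewrite -[RHS]adde0; congr (_ + _)%E.
rewrite /pr PU; have /= -> := measure_bigsetU P mF tF n.+1.
rewrite (eq_bigr (fun j : 'I_n.+1 => (pr P (F j))%:E)); last by move=> j _; exact: prE.
by rewrite sumEFin.
Qed.

Lemma backward_induction N Inv B (F G : seq nat -> R) :
  (forall s j, Inv s -> ~ B s -> (j <= size s)%N -> Inv (rcons s j)) ->
  (forall s, Inv s -> size s = N \/ B s -> F s <= G s) ->
  (forall s, Inv s -> ~ B s -> (size s < N)%N ->
     F s <= \sum_(j < (size s).+1) F (rcons s (val j))) ->
  (forall s, Inv s -> ~ B s -> (size s < N)%N ->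
     \sum_(j < (size s).+1) G (rcons s (val j)) <= G s) ->
  forall s, Inv s -> (size s <= N)%N -> F s <= G s.
Proof.
move=> InvS end_ subF superG s Is sN.
have [k kN] : exists k, (size s + k = N)%N by exists (N - size s)%N; rewrite subnKC.
elim: k s Is {sN} kN => [|k IH] s Is kN; first by apply: end_ => //; left; rewrite -kN addn0.
have [Bs|Bs] := pselect (B s); first by apply: end_ => //; right.
have sN : (size s < N)%N by rewrite -kN -addSnnS leq_addr.
apply: (le_trans (subF _ Is Bs sN)); apply: le_trans (superG _ Is Bs sN).
apply: ler_sum => j _; apply: IH; last by rewrite size_rcons addSnnS.
by apply: InvS => //; rewrite -ltnS; exact: ltn_ord.
Qed.

Definition hit_within B n N : set T :=
  [set w | exists m, [/\ (n <= m)%N, (m <= N)%N & B (hist m w)]].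

Definition hit B n : set T := [set w | exists2 m, (n <= m)%N & B (hist m w)].

Lemma measurable_hit_within B n N : measurable (hit_within B n N).
Proof.
have -> : hit_within B n N = \bigcup_(m in [set m | (n <= m <= N)%N]) [set w | B (hist m w)].
  apply/seteqP; split => w.
    by move=> [m [nm mN Bm]]; exists m => //=; rewrite nm.
  by move=> [m /= /andP[nm mN] Bm]; exists m.
by apply: bigcup_measurable => m _; exact: measurable_hist.
Qed.

Lemma hitE B n : hit B n = \bigcup_N hit_within B n N.
Proof.
apply/seteqP; split => w; first by move=> [m nm Bm]; exists m => //; exists m.
by move=> [N _ [m [nm _ Bm]]]; exists m.
Qed.

Lemma measurable_hit B n : measurable (hit B n).
Proof. by rewrite hitE; apply: bigcupT_measurable => N; exact: measurable_hit_within. Qed.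

Lemma pr_hit_le X B n c : measurable X ->
  (forall N, (n <= N)%N -> pr P (X `&` hit_within B n N) <= c) -> pr P (X `&` hit B n) <= c.
Proof.
move=> mX le.
have -> : X `&` hit B n = \bigcup_N (X `&` hit_within B n (n + N)).
  rewrite -setI_bigcupr; congr (_ `&` _).
  apply/seteqP; split => w; first by move=> [m nm Bm]; exists m => //; exists m; rewrite leq_addl.
  by move=> [N _ [m [nm _ Bm]]]; exists m.
apply: pr_bigcup_le => [N|m m' mm' w [Xw [k [nk km Bk]]]|N].
- by apply: measurableI => //; exact: measurable_hit_within.
- by split => //; exists k; split => //; rewrite (leq_trans km)// leq_add2l.
by apply: le; rewrite leq_addr.
Qed.

Lemma hit_within_step B s N : ~ B s ->
  hit_within B (size s) N `&` cyl s = hit_within B (size s).+1 N `&` cyl s.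
Proof.
move=> Bs; apply/seteqP; split => w [[m [nm mN Bm]] sw]; split => //; exists m; split => //.
  rewrite ltn_neqAle nm andbT; apply/eqP => smE; apply: Bs.
  by rewrite -smE sw in Bm.
exact: ltnW.
Qed.

Lemma hit_within_end B s N : ~ B s -> size s = N ->
  hit_within B (size s) N `&` cyl s = set0.
Proof.
move=> Bs sN; rewrite hit_within_step//; apply/seteqP; split => // w [[m [nm mN _]] _].
by move: (leq_trans nm mN); rewrite sN ltnn.
Qed.

Lemma supermartingale_hit_le Inv B phi s :
  (forall t j, Inv t -> (j <= size t)%N -> Inv (rcons t j)) ->
  (forall t, Inv t -> 0 <= phi t) ->
  (forall t, Inv t -> B t -> 1 <= phi t) ->
  (forall t, Inv t -> ~ B t -> step_mean f phi t <= phi t) ->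
  Inv s -> pr P (cyl s `&` hit B (size s)) <= phi s * pr P (cyl s).
Proof.
move=> InvS phi0 phi1 super Is; apply: pr_hit_le => [|N sN]; first exact: measurable_cyl.
rewrite setIC.
apply: (@backward_induction N Inv B (fun t => pr P (hit_within B (size t) N `&` cyl t))
  (fun t => phi t * pr P (cyl t))) => //.
- by move=> t j It _; exact: InvS.
- move=> t It h; have [Bt|Bt] := pselect (B t).
    apply: (@le_trans _ _ (pr P (cyl t))); last by rewrite ler_peMl ?pr_ge0 ?phi1.
    apply: pr_le; [|exact: measurable_cyl|by move=> w []].
    by apply: measurableI; [exact: measurable_hit_within|exact: measurable_cyl].
  case: h => // tN; rewrite hit_within_end// pr_set0 mulr_ge0 ?pr_ge0 ?phi0//.
- move=> t It Bt tN; rewrite hit_within_step// pr_cyl_split; last exact: measurable_hit_within.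
  by apply: ler_sum => j _; rewrite size_rcons.
- by move=> t It Bt tN; rewrite pr_cyl_step ler_wpM2r ?pr_ge0// super.
Qed.

Lemma strong_markov_le A B rho s : measurable A -> 0 <= rho ->
  (forall t, B t -> pr P (A `&` cyl t) <= rho * pr P (cyl t)) ->
  pr P (A `&` cyl s `&` hit B (size s)) <= rho * pr P (hit B (size s) `&` cyl s).
Proof.
move=> mA rho0 AB; have mC := measurable_cyl s.
apply: pr_hit_le => [|N sN]; first exact: measurableI.
have mH n M : measurable (hit_within B n M) by exact: measurable_hit_within.
apply: (@le_trans _ _ (rho * pr P (hit_within B (size s) N `&` cyl s))); last first.
  rewrite ler_wpM2l//; apply: pr_le.
  - exact: measurableI.
  - by apply: measurableI => //; exact: measurable_hit.
  - by move=> w [[m [? ? ?]] ?]; split => //; exists m.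
rewrite setIAC.
apply: (@backward_induction N (fun=> True) B
  (fun t => pr P (A `&` hit_within B (size t) N `&` cyl t))
  (fun t => rho * pr P (hit_within B (size t) N `&` cyl t))) => //.
- move=> t _ h; have [Bt|Bt] := pselect (B t).
    have [tN|tN] := leqP (size t) N.
      have -> : hit_within B (size t) N `&` cyl t = cyl t.
        apply/seteqP; split => [w []//|w tw]; split => //.
        by exists (size t); split => //; rewrite tw.
      apply: le_trans (AB _ Bt); apply: pr_le.
      - by apply: measurableI; [exact: measurableI|exact: measurable_cyl].
      - by apply: measurableI => //; exact: measurable_cyl.
      - by move=> w [[? ?] ?].
    have -> : hit_within B (size t) N = set0.
      apply/seteqP; split => // w [m [tm mN _]].
      by move: (leq_trans tm mN); rewrite leqNgt tN.
    by rewrite setI0 !set0I pr_set0 mulr0.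
  case: h => // tN; rewrite -setIA hit_within_end// setI0 pr_set0.
  by rewrite mulr0.
- move=> t _ Bt tN; rewrite -setIA hit_within_step// setIA pr_cyl_split; last exact: measurableI.
  by apply: ler_sum => j _; rewrite size_rcons.
- move=> t _ Bt tN; rewrite [in leRHS]hit_within_step// pr_cyl_split// mulr_sumr.
  by apply: ler_sum => j _; rewrite size_rcons.
Qed.

End Cylinders.

(** * Almost sure behaviour *)

Definition valid (s : seq nat) : bool := all (fun x => (x < size s)%N) s.

Lemma valid_rcons s j : valid s -> (j <= size s)%N -> valid (rcons s j).
Proof.
move=> /allP vs js; rewrite /valid all_rcons size_rcons ltnS js/=.
by apply/allP => x /vs; exact: ltnW.
Qed.

Lemma valid_count0 s : valid s -> count_mem (size s) s = 0%N.
Proof. by move=> /allP vs; apply/count_memPn/negP => /vs; rewrite ltnn. Qed.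

(* [leader (take N s)] is the leader at the birth of node [N]. *)
Definition overtaken N (s : seq nat) : Prop :=
  (count_mem (leader (take N s)) s <= count_mem N s)%N.

Definition tie_at K u v (s : seq nat) : Prop :=
  [/\ (u <= size s)%N, (v <= size s)%N, count_mem u s = count_mem v s
    & (K <= count_mem u s)%N].

Section PersistentHub.
Variable t : nat -> nat.
Let h n := mkseq t n.

Hypothesis maxdeg_unbounded : forall K, exists n, (K < hist_maxdeg (h n))%N.
Hypothesis overtaken_finite : exists N0, forall N, (N0 <= N)%N ->
  forall n, (N <= n)%N -> ~ overtaken N (h n).
Hypothesis tie_bounded : forall u v, u != v ->
  exists K, forall n, ~ tie_at K u v (h n).

Let size_h n : size (h n) = n. Proof. exact: size_mkseq. Qed.

Lemma maxdeg_hist n : maxdeg t n = hist_maxdeg (h n).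
Proof.
rewrite /maxdeg /hist_maxdeg size_h; apply: eq_bigr => i _.
exact: outdegE.
Qed.

Lemma hist_maxdeg_homo m n : (m <= n)%N -> (hist_maxdeg (h m) <= hist_maxdeg (h n))%N.
Proof.
move=> /subnK <-; elim: (n - m)%N => // k IH.
by rewrite addSn /h mkseqS (leq_trans IH)// hist_maxdeg_rcons.
Qed.

Lemma exists_unique_persistent_hub : exists u, unique_persistent_hub t u.
Proof.
have [N0 noov] := overtaken_finite.
have /choice[Kf KfP] : forall uv : nat * nat, exists K,
    uv.1 != uv.2 -> forall n, ~ tie_at K uv.1 uv.2 (h n).
  move=> [u v] /=; have [->|uv] := eqVneq u v; first by exists 0%N.
  by have [K HK] := tie_bounded uv; exists K.
pose Kmax := \max_(u < N0) \max_(v < N0) Kf (val u, val v).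
have KmaxP u v : (u < N0)%N -> (v < N0)%N -> (Kf (u, v) <= Kmax)%N.
  move=> uN vN; apply: (@leq_trans (\max_(v < N0) Kf (u, val v))).
    exact: (@leq_bigmax _ (fun v : 'I_N0 => Kf (u, val v)) (Ordinal vN)).
  exact: (@leq_bigmax _ (fun u : 'I_N0 => \max_(v < N0) Kf (val u, val v)) (Ordinal uN)).
have [n0 Mn0] := maxdeg_unbounded Kmax.
pose n1 := maxn n0 N0.
have small n v : (n1 <= n)%N -> (v <= n)%N -> count_mem v (h n) = hist_maxdeg (h n) ->
    (v < N0)%N.
  move=> nn vn vM; rewrite ltnNge; apply/negP => Nv.
  apply: (noov _ Nv _ vn); rewrite /overtaken vM leq_hist_maxdeg// size_h.
  apply: (leq_trans _ vn); apply: (leq_trans (leader_le _)).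
  by rewrite size_take size_h; case: ifP => //; rewrite ltnNge => /negbFE.
have uniq n v v' : (n1 <= n)%N -> (v <= n)%N -> (v' <= n)%N ->
    count_mem v (h n) = hist_maxdeg (h n) ->
    count_mem v' (h n) = hist_maxdeg (h n) -> v = v'.
  move=> nn vn vn' vM vM'; apply/eqP/negP => /negP vv'.
  apply: (KfP (v, v') vv' n); split; rewrite /= ?size_h// ?vM//.
  apply: (leq_trans (KmaxP _ _ (small _ _ nn vn vM) (small _ _ nn vn' vM'))).
  apply: (leq_trans (ltnW Mn0)); apply: hist_maxdeg_homo.
  exact: leq_trans (leq_maxl _ _) nn.
pose l n := leader (h n).
have ln n : (l n <= n)%N by rewrite (leq_trans (leader_le _))// size_h.
have lM n : count_mem (l n) (h n) = hist_maxdeg (h n) by exact: count_mem_leader.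
have lS n : (n1 <= n)%N -> l n.+1 = l n.
  move=> nn; have nn' := leqW nn.
  apply: (uniq n.+1) => //; first exact: leqW.
  have vn : (l n.+1 <= n)%N.
    apply: ltnW; apply: (leq_trans (small _ _ nn' (ln _) (lM _))).
    exact: leq_trans (leq_maxr _ _) nn.
  have [e|ne] := eqVneq (l n.+1) (l n); first by rewrite -e.
  have lt : (count_mem (l n.+1) (h n) < hist_maxdeg (h n))%N.
    rewrite ltn_neqAle leq_hist_maxdeg ?size_h// andbT; apply/eqP => e.
    by move/eqP: ne; apply; exact: uniq e (lM n).
  apply/eqP; rewrite eqn_leq leq_hist_maxdeg ?size_h ?(leqW (ln n))// andTb.
  have cS x : count_mem x (h n.+1) = (count_mem x (h n) + (t n == x))%N.
    by rewrite /h mkseqS count_mem_rcons.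
  rewrite -(lM n.+1) !cS. rewrite lM.
  by apply: (@leq_trans (count_mem (l n.+1) (h n)).+1);
    [rewrite -[leqRHS]addn1 leq_add2l; case: eqP|rewrite (leq_trans lt)// leq_addr].
have lE n : (n1 <= n)%N -> l n = l n1.
  move=> /subnK <-; elim: (n - n1)%N => // k IH.
  by rewrite addSn lS// leq_addl.
exists (l n1); split.
  exists n1 => n nn; rewrite -(lE n nn) maxdeg_hist outdegE; split; first exact: ln.
  exact: lM.
move=> v [N' HN']; pose n := maxn n1 N'.
have [vn] := HN' n (leq_maxr _ _); rewrite maxdeg_hist outdegE => vM.
by rewrite -(lE n (leq_maxl _ _)); apply: (uniq n) => //; exact: leq_maxl.
Qed.

End PersistentHub.

Section AlmostSure.
Context {d : measure_display} {T : measurableType d} {R : realType}.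
Variables (P : probability T R) (f : nat -> R) (J : nat -> T -> nat) (kappa : R).
Hypothesis f_gt0 : forall n, 0 < f n.
Hypothesis kappa_gt0 : 0 < kappa.
Hypothesis f_quasi : forall n i, (i <= n)%N ->
  f i / i.+1%:R <= kappa * (f n / n.+1%:R).
Hypothesis GPA : is_GPA_tree P f J.
Implicit Types (s : seq nat) (n N u v : nat) (X : set T).

Local Notation cyl := (cyl J).
Local Notation hit := (hit J).
Local Notation hist := (hist J).
Local Notation pr := (pr P).
Let mcyl s : measurable (cyl s). Proof. exact: (measurable_cyl GPA). Qed.
Let mhit B n : measurable (hit B n). Proof. exact: (measurable_hit GPA). Qed.

Lemma maxdeg_decay (p c K : R) m0 N X s : 0 <= p -> 0 <= c -> 0 <= K ->
  measurable X ->
  (forall m, (m0 <= m)%N -> c * (2 * kappa) * (m.+1%:R + p) <= p * m.+1%:R) ->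
  (forall t, valid t -> (m0 <= hist_maxdeg t)%N -> size t = N ->
     pr (X `&` cyl t) <= K / growth p (hist_maxdeg t) * pr (cyl t)) ->
  valid s -> (m0 <= hist_maxdeg s)%N -> (size s <= N)%N ->
  pr (X `&` cyl s) <=
    K * (growth c (size s) / growth c N) / growth p (hist_maxdeg s) * pr (cyl s).
Proof.
move=> p0 c0 K0 mX hc hX vs ms sN.
have gc n : 0 < growth c n by exact: growth_gt0.
have gp n : 0 < growth p n by exact: growth_gt0.
pose psi (t : seq nat) := K * (growth c (size t) / growth c N) / growth p (hist_maxdeg t).
apply: (@backward_induction _ N (fun t => valid t /\ (m0 <= hist_maxdeg t)%N)
  (fun=> False) (fun t => pr (X `&` cyl t)) (fun t => psi t * pr (cyl t))) => //.
- move=> t j [vt mt] _ jt; split; first exact: valid_rcons.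
  exact: leq_trans mt (hist_maxdeg_rcons _ _).
- by move=> t [vt mt] [tN|//]; rewrite /psi tN divff ?lt0r_neq0// mulr1 hX.
- by move=> t _ _ _; rewrite (pr_cyl_split GPA).
move=> t [vt mt] _ tN; rewrite (pr_cyl_step GPA) ler_wpM2r ?pr_ge0//.
pose C := K * (growth c (size t).+1 / growth c N).
have -> : step_mean f psi t = C * step_mean f (fun t' => (growth p (hist_maxdeg t'))^-1) t.
  by rewrite -step_meanZ; apply: eq_bigr => j _; rewrite /psi size_rcons.
have C0 : 0 <= C by rewrite mulr_ge0// divr_ge0// ltW.
apply: (le_trans (ler_wpM2l C0 (step_mean_inv_growth f_gt0 kappa_gt0 f_quasi p0 (hc _ mt)))).
rewrite mulrA ler_wpM2r ?invr_ge0 ?(ltW (gp _))// /C -!mulrA ler_wpM2l//.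
rewrite growthS -!mulrA ler_wpM2l ?(ltW (gc _))//.
set x := c / _; rewrite mulrCA ler_piMr ?invr_ge0 ?(ltW (gc _))//.
have := sqr_ge0 x; lra.
Qed.

Lemma pr_maxdeg_bounded K :
  pr (~` hit (fun s => (K < hist_maxdeg s)%N : Prop) 0) = 0.
Proof.
set X := ~` _; have mX : measurable X by exact: measurableC.
pose c := (4 * kappa)^-1; have c0 : 0 < c by rewrite invr_gt0 mulr_gt0.
have g1 n : 0 < growth 1 n :> R by exact: growth_gt0.
have X_le N : pr X <= growth 1 K / growth c N.
  have := @maxdeg_decay 1 c (growth 1 K) 0 N X [::] ler01 (ltW c0) (ltW (g1 K)) mX.
  rewrite cyl_nil setIT.
  have -> : hist_maxdeg [::] = 0%N by rewrite /hist_maxdeg big1.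
  rewrite !growth0 div1r invr1 mulr1 /pr probability_setT mulr1.
  apply=> //.
    move=> m _; rewrite [leLHS](_ : _ = (m.+1%:R + 1) / 2); last first.
      by rewrite /c; field; rewrite lt0r_neq0.
    by rewrite mul1r -natr1; have : 0 <= m%:R :> R by []; lra.
  move=> t vt _ tN; have [tK|tK] := leqP (hist_maxdeg t) K.
    apply: (@le_trans _ _ (pr (cyl t))).
      by apply: pr_le; [exact: measurableI|exact: mcyl|move=> w []].
    rewrite ler_peMl ?pr_ge0// ler_pdivlMr// mul1r.
    exact: growth_le.
  rewrite (_ : X `&` cyl t = set0) ?measure0; last first.
    apply/seteqP; split => // w [Xw tw]; apply: Xw.
    by exists (size t) => //; rewrite tw.
  by rewrite mulr_ge0 ?pr_ge0// divr_ge0// ltW.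
apply/eqP; rewrite eq_le pr_ge0 andbT leNgt; apply/negP => X0.
have [N] := growth_unbounded (growth 1 K / pr X) c0.
rewrite ltr_pdivrMr// mulrC -ltr_pdivrMr ?growth_gt0 ?(ltW c0)//.
by rewrite ltNge X_le.
Qed.

Lemma pr_overtaken (p : R) N s : 0 <= p -> valid s -> size s = N ->
  (0 < hist_maxdeg s)%N -> 2 * (kappa ^+ 2 * p) ^+ 2 <= (hist_maxdeg s)%:R ->
  pr (hit (overtaken N) N `&` cyl s) <= 2 / growth p (hist_maxdeg s) * pr (cyl s).
Proof.
move=> p0 vs sN m0 mbig; set m := hist_maxdeg s in m0 mbig *; pose u := leader s.
have um : count_mem u s = m by exact: count_mem_leader.
have N0 : count_mem N s = 0%N by rewrite -sN valid_count0.
have uN : u != N by apply/eqP => e; move: m0; rewrite -um e N0.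
have us : (u <= N)%N by rewrite -sN leader_le.
pose lambda := kappa * p * (f m / m.+1%:R).
have gp : 0 < growth p m by exact: growth_gt0.
pose phi t := 2 / growth p m * duel f lambda m 0 u N t.
have lambda0 : 0 <= lambda by rewrite !mulr_ge0 ?divr_ge0// ltW.
have phis : phi s = 2 / growth p m by rewrite /phi /duel um N0 !big_geq// !mulr1.
rewrite setIC -phis; suff : pr (cyl s `&` hit (overtaken N) (size s)) <= phi s * pr (cyl s).
  by rewrite sN.
apply: (@supermartingale_hit_le _ _ _ P f J GPA
  (fun t => [/\ (N <= size t)%N, take N t = s & (m <= count_mem u t)%N])
  (overtaken N) phi s) => //.
- move=> t j [Nt ts mt] _; rewrite size_rcons count_mem_rcons; split.
  + exact: leqW.
  + by rewrite -cats1 takel_cat.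
  + exact: leq_trans mt (leq_addr _ _).
- move=> t _; rewrite mulr_ge0 ?divr_ge0 ?(ltW gp)//.
  apply: mulr_ge0; last by apply: prodr_ge0 => i _; rewrite addr_ge0 ?divr_ge0// ltW.
  rewrite big_nat prodr_ge0// => i /andP[mi _]; rewrite subr_ge0 ler_pdivrMr// mul1r.
  apply: (@le_trans _ _ (kappa * p * (kappa * (f i / i.+1%:R)))).
    by rewrite ler_wpM2l ?f_quasi// mulr_ge0// ltW.
  rewrite [leLHS](_ : _ = kappa ^+ 2 * p / i.+1%:R * f i); last by ring.
  rewrite ler_piMl ?(ltW (f_gt0 _))// ler_pdivrMr// mul1r.
  have : m%:R <= i%:R :> R by rewrite ler_nat.
  rewrite -natr1; move: mbig; set y := kappa ^+ 2 * p; have : 0 <= m%:R :> R by [].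
  by nra.
- move=> t [Nt ts mt]; rewrite /overtaken ts -/u => ut.
  rewrite /phi -ler_pdivrMl ?divr_gt0// mulr1 invf_div.
  apply: (@overtake_duel _ f kappa) => //.
  by rewrite mt.
- move=> t [Nt ts mt] _; rewrite /phi step_meanZ step_mean_duel//.
  exact: leq_trans us Nt.
by split; rewrite ?sN -?sN ?take_size ?um.
Qed.

Lemma ae_not X : measurable X -> pr X = 0 -> {ae P, forall w, ~ X w}.
Proof.
move=> mX X0; apply: negligibleS (pr_eq0_negligible mX X0) => w.
by move=> /contrapT.
Qed.

Lemma ae_forall_countable (U : countType) (Q : U -> T -> Prop) :
  (forall x, {ae P, forall w, Q x w}) -> {ae P, forall w, forall x, Q x w}.
Proof.
move=> aeQ; pose Q' n w := if unpickle n is Some x then Q x w else True.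
have : {ae P, forall w, forall n, Q' n w}.
  apply: ae_foralln => n; rewrite /Q'; case: unpickle => [x|]; first exact: aeQ.
  exact: aeW.
by apply: filterS => w Qw x; have := Qw (pickle x); rewrite /Q' pickleK.
Qed.

Lemma ae_valid : {ae P, forall w, forall n, valid (hist n w)}.
Proof.
have pos s : pr (cyl s) != 0 -> valid s.
  elim/last_ind: s => // s j IH; rewrite (pr_cyl_rcons GPA) mulf_eq0 negb_or.
  case: ifP => [js /andP[/IH vs _]|_]; first exact: valid_rcons.
  by rewrite eqxx andbF.
have : {ae P, forall w, forall s, cyl s w -> valid s}.
  apply: ae_forall_countable => s; have [vs|vs] := boolP (valid s); first exact: aeW.
  apply: filterS (ae_not (mcyl s) _) => [w //|].
  by apply/eqP; apply: contraNT vs; exact: pos.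
by apply: filterS => w h n; apply: h; exact: cyl_hist.
Qed.

Lemma ae_maxdeg_unbounded :
  {ae P, forall w, forall K, exists n, (K < hist_maxdeg (hist n w))%N}.
Proof.
apply: ae_foralln => K.
apply: filterS (ae_not _ (pr_maxdeg_bounded K)) => [w /contrapT[n _ Kn]|].
  by exists n.
exact: measurableC.
Qed.

Lemma sum_inv_mulS M : \sum_(0 <= N < M) (N.+1%:R * N.+2%:R)^-1 = 1 - M.+1%:R^-1 :> R.
Proof.
elim: M => [|M IH]; first by rewrite big_geq// invr1 subrr.
rewrite big_nat_recr//= IH -[M.+2%:R]natr1; field.
by rewrite ?nat1r ?natr1 ?pnatr_eq0.
Qed.

Definition overtake_exponent : R := 8 * kappa.

Definition overtake_threshold : nat :=
  (Num.trunc (2 * (kappa ^+ 2 * overtake_exponent) ^+ 2 + overtake_exponent)).+1.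

Lemma pr_overtaken_summable s N : valid s ->
  (overtake_threshold <= hist_maxdeg s)%N -> (size s <= N)%N ->
  pr (hit (overtaken N) N `&` cyl s) <=
    4 * growth 2 (size s) * (N.+1%:R * N.+2%:R)^-1.
Proof.
move=> vs ms sN; pose p := overtake_exponent.
have p0 : 0 <= p by rewrite mulr_ge0// ltW.
have m0P m : (overtake_threshold <= m)%N ->
    (0 < m)%N /\ 2 * (kappa ^+ 2 * p) ^+ 2 + p <= m%:R.
  move=> mm; split; first exact: leq_trans mm.
  apply: (@le_trans _ _ overtake_threshold%:R); last by rewrite ler_nat.
  exact/ltW/truncnS_gt.
have q0 : 0 <= (kappa ^+ 2 * p) ^+ 2 by exact: sqr_ge0.
have g0 : 0 < growth 2 (size s) :> R by exact: growth_gt0.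
apply: le_trans (maxdeg_decay (p := p) (c := 2) (K := 2) p0 _ _ (mhit _ _) _ _ vs ms sN) _ => //.
- move=> m /m0P[_ mp]; rewrite -natr1.
  rewrite [leLHS](_ : _ = kappa * (4 * (m%:R + 1 + p))); last by ring.
  rewrite [leRHS](_ : _ = kappa * (8 * (m%:R + 1))); last by rewrite /p /overtake_exponent; ring.
  by rewrite ler_wpM2l ?(ltW kappa_gt0)//; lra.
- move=> t vt /m0P[mt0 mt] tN; apply: pr_overtaken => //; lra.
set G := growth 2 (size s) in g0 *; rewrite (growth2 _ N).
rewrite [leRHS](_ : _ = 2 * (G / (N.+1%:R * N.+2%:R / 2))); last first.
  by field; rewrite -?natrD ?nat1r ?natr1 ?pnatr_eq0.
rewrite -[leLHS]mulrA ler_piMr//.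
  by rewrite mulr_ge0// divr_ge0 ?(ltW g0)// divr_ge0// mulr_ge0.
have c1 : pr (cyl s) <= 1.
  by rewrite -lee_fin -(prE P (mcyl s)) probability_le1.
rewrite mulrC ler_pdivrMr ?growth_gt0// mul1r (le_trans c1)//.
by rewrite -(growth0 p) growth_le.
Qed.

Lemma ae_overtaken_finite : {ae P, forall w, exists N0, forall N, (N0 <= N)%N ->
  forall n, (N <= n)%N -> ~ overtaken N (hist n w)}.
Proof.
have ae_cyl s : valid s -> (overtake_threshold <= hist_maxdeg s)%N ->
    {ae P, forall w, cyl s w -> exists N0, forall N, (N0 <= N)%N ->
      forall n, (N <= n)%N -> ~ overtaken N (hist n w)}.
  move=> vs ms.
  pose F N := if (size s <= N)%N then hit (overtaken N) N `&` cyl s else set0.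
  have mF N : measurable (F N) by rewrite /F; case: ifP => // _; exact: measurableI.
  pose C : R := 4 * growth 2 (size s).
  have C0 : 0 <= C by rewrite mulr_ge0// ltW// growth_gt0.
  have FC N : pr (F N) <= C * (N.+1%:R * N.+2%:R)^-1.
    rewrite /F; case: ifP => [sN|_]; first exact: pr_overtaken_summable.
    by rewrite pr_set0 mulr_ge0.
  have F0 : P (lim_sup_set F) = 0%E.
    apply: lim_sup_set_cvg0 => //; apply: (@le_lt_trans _ _ C%:E); last exact: ltry.
    apply: lime_le; first by apply: is_cvg_nneseries.
    apply: nearW => M; rewrite (eq_bigr (fun N => (pr (F N))%:E)); last first.
      by move=> N _; exact: prE.
    rewrite sumEFin lee_fin.
    apply: (@le_trans _ _ (\sum_(0 <= N < M) C * (N.+1%:R * N.+2%:R)^-1)).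
      by apply: ler_sum => N _; exact: FC.
    by rewrite -mulr_sumr sum_inv_mulS ler_piMr// gerBl.
  have mL : measurable (lim_sup_set F).
    apply: bigcapT_measurable => n; apply: bigcup_measurable => N _; exact: mF.
  have := ae_not mL; rewrite /pr F0 => /(_ erefl); apply: filterS => w nL sw.
  have [n nF] : exists n, forall N, (n <= N)%N -> ~ F N w.
    apply: contrapT => h; apply: nL => n _; apply: contrapT => h'.
    by apply: h; exists n => N nN FN; apply: h'; exists N.
  exists (maxn n (size s)) => N; rewrite geq_max => /andP[nN sN] k Nk ov.
  by apply: (nF N nN); rewrite /F sN; split => //; exists k.
have : {ae P, forall w, forall s, valid s -> (overtake_threshold <= hist_maxdeg s)%N ->
    cyl s w -> exists N0, forall N, (N0 <= N)%N ->
      forall n, (N <= n)%N -> ~ overtaken N (hist n w)}.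
  apply: ae_forall_countable => s.
  have [vs|vs] := boolP (valid s); last by apply: aeW => w.
  have [ms|ms] := leqP overtake_threshold (hist_maxdeg s); last by apply: aeW => w.
  by apply: filterS (ae_cyl s vs ms) => w h _ _.
apply: filterS3 ae_valid ae_maxdeg_unbounded => w vw uw h.
have [n hn] := uw overtake_threshold.
by apply: (h (hist n w)); [exact: vw|exact: ltnW|exact: cyl_hist].
Qed.

Definition tie_bound : R := 128 * kappa ^+ 2.

Definition tie_value : R := tie_bound ^+ 2 / 2 + (1 - tie_bound).

Lemma tie_value_gt0 : 0 < tie_value.
Proof.
have k1 := kappa_ge1 f_gt0 f_quasi.
have : 1 <= kappa ^+ 2 by rewrite exprn_ege1.
by rewrite /tie_value /tie_bound; set y := kappa ^+ 2; nra.
Qed.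

Lemma pr_tie_again u v s : u != v -> tie_at 1 u v s ->
  exists K, pr (cyl s `&` hit (tie_at K u v) (size s)) <=
    tie_value / (tie_value + 1) * pr (cyl s).
Proof.
move=> uv [us vs uvE u1]; pose k := count_mem u s.
have [lambda [K [quarter sum_le sum_ge]]] := tie_scale f_gt0 kappa_gt0 f_quasi u1.
have g0 := tie_value_gt0; have g1 : 0 < tie_value + 1 by rewrite addr_gt0.
exists K; pose phi t := (tie_value + 1)^-1 * tie_potential f lambda tie_bound k u v t.
have <- : phi s = tie_value / (tie_value + 1).
  by rewrite /phi (tie_potential_start _ _ _ (erefl : count_mem u s = k)) 1?mulrC// -uvE.
apply: (@supermartingale_hit_le _ _ _ P f J GPA
  (fun t => [/\ (u <= size t)%N, (v <= size t)%N, (k <= count_mem u t)%N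
                & (k <= count_mem v t)%N]) (tie_at K u v) phi s) => //.
- move=> t j [ut vt ku kv] _; rewrite size_rcons !count_mem_rcons.
  by split; rewrite ?leqW// (leq_trans _ (leq_addr _ _)).
- move=> t _; rewrite mulr_ge0 ?invr_ge0 ?(ltW g1)//.
  exact: tie_potential_ge0.
- move=> t [ut vt ku kv] [_ _ tE Kt].
  rewrite /phi -ler_pdivrMl ?invr_gt0// mulr1 invrK.
  apply: (tie_potential_tie quarter sum_le tE (sum_ge _ Kt)).
    by rewrite invr_ge0 mulr_ge0 ?exprn_ge0// ltW.
  by rewrite /tie_bound le_eqVlt; apply/orP; left; apply/eqP; field; rewrite lt0r_neq0.
- by move=> t [ut vt ku kv] _; rewrite /phi step_meanZ step_mean_tie_potential.
by split; rewrite // -uvE.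
Qed.

Lemma pr_ties_unbounded u v : u != v ->
  pr (\bigcap_K hit (tie_at K.+1 u v) 0) = 0.
Proof.
move=> uv; set A := \bigcap_K _; pose rho := tie_value / (tie_value + 1).
have g0 := tie_value_gt0; have g1 : 0 < tie_value + 1 by rewrite addr_gt0.
have rho0 : 0 < rho by rewrite divr_gt0.
have rho1 : rho < 1 by rewrite ltr_pdivrMr// mul1r ltrDl.
have mA : measurable A by apply: bigcapT_measurable => K; exact: mhit.
have A_cyl s : tie_at 1 u v s -> pr (A `&` cyl s) <= rho * pr (cyl s).
  move=> ts; have [K HK] := pr_tie_again uv ts.
  apply: le_trans HK; apply: pr_le.
  - exact: measurableI.
  - exact: measurableI.
  move=> w [Aw sw]; split => //; have [m _ [um vm uvE Ku]] := Aw (maxn K (size s)) I.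
  exists m; last first.
    by split => //; apply: leq_trans Ku; rewrite leqW// leq_maxl.
  have := leq_trans Ku (count_size _ _); rewrite size_hist; apply: leq_trans.
  by rewrite leqW// leq_maxr.
have A_le K : pr A / rho <= pr (hit (tie_at K.+1 u v) 0).
  rewrite ler_pdivrMr// mulrC.
  have := @strong_markov_le _ _ _ P f J GPA A (tie_at K.+1 u v) rho [::] mA (ltW rho0).
  rewrite cyl_nil !setIT (_ : A `&` hit (tie_at K.+1 u v) 0 = A).
    apply=> t [ut vt uvE Ku]; apply: A_cyl; split => //; exact: leq_trans Ku.
  by apply/seteqP; split => [w []//|w Aw]; split => //; exact: Aw.
have : pr A / rho <= pr A.
  apply: pr_bigcap_ge => // m n mn w [i _ [ui vi uvE ni]]; exists i => //.
  by split => //; apply: leq_trans ni.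
rewrite ler_pdivrMr// => h; have := pr_ge0 P A.
by move=> A0; apply/eqP; rewrite eq_le A0 andbT; nra.
Qed.

Lemma ae_tie_bounded : {ae P, forall w, forall u v, u != v ->
  exists K, forall n, ~ tie_at K u v (hist n w)}.
Proof.
have : {ae P, forall w, forall uv : nat * nat, uv.1 != uv.2 ->
    exists K, forall n, ~ tie_at K uv.1 uv.2 (hist n w)}.
  apply: ae_forall_countable => -[u v] /=.
  have [_|uv] := eqVneq u v; first by apply: aeW => w.
  apply: filterS (ae_not _ (pr_ties_unbounded uv)) => [w nA _|]; last first.
    by apply: bigcapT_measurable => K; exact: mhit.
  apply: contrapT => h; apply: nA => K _; apply: contrapT => h'.
  by apply: h; exists K.+1 => n tn; apply: h'; exists n.
by apply: filterS => w h u v; exact: (h (u, v)).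
Qed.

End AlmostSure.

Local Close Scope classical_set_scope.
Unset Implicit Arguments.

Theorem theorem2p17 (d : measure_display) (T : measurableType d) (R : realType)
  (P : probability T R) (f : nat -> R) (J : nat -> T -> nat) (kappa : R) :
  (forall n, 0 < f n) ->
  0 < kappa ->
  (forall n i, (i <= n)%N -> f i / (i.+1)%:R <= kappa * (f n / (n.+1)%:R)) ->
  is_GPA_tree P f J ->
  {ae P, forall w, exists u, unique_persistent_hub (fun k => J k w) u}.
Proof.
move=> f_gt0 kappa_gt0 f_quasi GPA.
apply: filterS3 (ae_maxdeg_unbounded f_gt0 kappa_gt0 f_quasi GPA)
  (ae_overtaken_finite f_gt0 kappa_gt0 f_quasi GPA)
  (ae_tie_bounded f_gt0 kappa_gt0 f_quasi GPA) => w.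
exact: exists_unique_persistent_hub.
Qed.
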